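(* There is no minimal conformal immersion $X:\Sigma\to\mathbb{S}^2\times\mathbb{R}$ whose Gauss map $g:\Sigma\to\bar{\mathbb{C}}$ is a non-constant anti-holomorphic map.
   Context: Model: $\mathbb{S}^2\times\mathbb{R}$ (with $\mathbb{S}^2$ the unit sphere and the product metric) is identified with $\mathbb{R}^3\setminus\{0\}$ with the metric $d\mu^2=|x|^{-2}(dx_1^2+dx_2^2+dx_3^2)$ through the isometry $(y,t)\mapsto e^t y$. $\Sigma$ is a connected oriented Riemannian surface, with orientation-compatible local conformal coordinates $z=u+iv$; minimal means zero mean curvature with respect to $d\mu^2$. Gauss map: $E_j(x)=|x|\partial_{x_j}$, $j=1,2,3$, is a global orthonormal frame. Let $N=N_1E_1+N_2E_2+N_3E_3$ be the unit normal of $X$ in the direction of $X_u\times X_v$. The Gauss map of $X$ is $$g=\frac{N_1+iN_2}{1+N_3}:\Sigma\to\bar{\mathbb{C}}=\mathbb{C}\cup\{\infty\},$$ i.e. $N\in\mathbb{S}^2\subset\mathbb{R}^3$ composed with stereographic projection from the south pole. Anti-holomorphic refers to the Riemann surface structure on $\Sigma$ defined by the coordinates $z$ and the standard one on the Riemann sphere $\bar{\mathbb{C}}$ (i.e. $g_z=0$ where $g\ne\infty$). *)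

(* Defs.v *)
From HB Require Import structures.
From mathcomp Require Import all_boot all_order all_algebra.
From mathcomp Require Import complex.
From mathcomp Require Import all_classical all_reals all_analysis.
Set Implicit Arguments.
Unset Strict Implicit.
Unset Printing Implicit Defensive.
Import Order.TTheory GRing.Theory Num.Theory.
Import numFieldNormedType.Exports.
Local Open Scope classical_set_scope.
Local Open Scope ring_scope.
Local Open Scope complex_scope.

(* Vectors are row vectors, so ['J F x] maps a tangent vector [v] to
   [v *m 'J F x]. *)

Definition partial (R : realType) (n : nat) (W : normedModType R) (i : 'I_n)
    (f : 'rV[R]_n -> W) (x : 'rV[R]_n) : W :=
  'D_(delta_mx 0 i) f x.

(* [f] is of class C^k at the points of [D]; meaningful for [D] open. *)
Fixpoint Ck_on (R : realType) (n : nat) (W : normedModType R) (k : nat)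
    (D : set 'rV[R]_n) (f : 'rV[R]_n -> W) : Prop :=
  match k with
  | 0 => forall x, D x -> {for x, continuous f}
  | k'.+1 => (forall x, D x -> differentiable f x) /\
             (forall i, Ck_on k' D (partial i f))
  end.

Definition smooth_on (R : realType) (n : nat) (W : normedModType R)
    (D : set 'rV[R]_n) (f : 'rV[R]_n -> W) : Prop :=
  forall k, Ck_on k D f.

(* A Riemannian metric on (part of) R^n is given by its Gram matrices
   [h x] in the coordinate basis. *)
Definition metric_dot (R : realType) (n : nat) (G : 'M[R]_n)
    (v w : 'rV[R]_n) : R :=
  (v *m G *m w^T) 0 0.

Definition pullback (R : realType) (m n : nat) (h : 'rV[R]_n -> 'M[R]_n)
    (F : 'rV[R]_m -> 'rV[R]_n) (x : 'rV[R]_m) : 'M[R]_m :=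
  'J F x *m h (F x) *m ('J F x)^T.

(* The surface Sigma: an oriented surface with a Riemannian metric, given by an
   atlas of orientation-compatible conformal charts z = (u, v).  [chart_img i] is
   the image of the i-th chart, and the metric is
   [conf_factor i z * (du^2 + dv^2)] there. *)
Record riemannian_surface (R : realType) (T : topologicalType) := {
  chart_index : Type;
  chart_dom : chart_index -> set T;
  chart : chart_index -> T -> 'rV[R]_2;
  param : chart_index -> 'rV[R]_2 -> T;
  conf_factor : chart_index -> 'rV[R]_2 -> R;
  chart_img := fun i => chart i @` chart_dom i;
  surf_metric := fun i z => (conf_factor i z)%:M : 'M[R]_2;
  transition := fun i j => chart j \o param i;
  overlap := fun i j => chart i @` (chart_dom i `&` chart_dom j);
  chart_dom_open : forall i, open (chart_dom i);
  chart_dom_cover : forall p, exists i, chart_dom i p;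
  chart_img_open : forall i, open (chart_img i);
  chartK : forall i p, chart_dom i p -> param i (chart i p) = p;
  chart_continuous : forall i, {within chart_dom i, continuous (chart i)};
  param_continuous : forall i, {within chart_img i, continuous (param i)};
  transition_smooth : forall i j, smooth_on (overlap i j) (transition i j);
  transition_oriented : forall i j z, overlap i j z ->
    0 < \det ('J (transition i j) z);
  conf_factor_smooth : forall i, smooth_on (chart_img i) (conf_factor i);
  conf_factor_gt0 : forall i z, chart_img i z -> 0 < conf_factor i z;
  metric_compat : forall i j z, overlap i j z ->
    pullback (surf_metric j) (transition i j) z = surf_metric i z
}.

(* The library norm on ['rV[R]_3] is the sup norm, hence this definition. *)
Definition enorm (R : realType) (x : 'rV[R]_3) : R :=
  Num.sqrt (\sum_i x 0 i ^+ 2).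

(* S^2 x R is identified with R^3 \ {0} through (y, t) |-> e^t y, which carries
   the product metric to |x|^-2 (dx_1^2 + dx_2^2 + dx_3^2). *)
Definition dmu2 (R : realType) (x : 'rV[R]_3) : 'M[R]_3 :=
  (enorm x ^- 2)%:M.

Definition frame (R : realType) (j : 'I_3) (x : 'rV[R]_3) : 'rV[R]_3 :=
  enorm x *: delta_mx 0 j.

Section LocalGeometry.
Variable R : realType.

Definition christoffel (n : nat) (h : 'rV[R]_n -> 'M[R]_n)
    (k i j : 'I_n) (x : 'rV[R]_n) : R :=
  2^-1 * \sum_l invmx (h x) k l *
    (partial i (fun y => h y j l) x + partial j (fun y => h y i l) x
     - partial l (fun y => h y i j) x).

(* Covariant derivative of [partial b F] along [partial a F], for the
   Levi-Civita connection of [h]. *)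
Definition cov_partial (m n : nat) (h : 'rV[R]_n -> 'M[R]_n)
    (F : 'rV[R]_m -> 'rV[R]_n) (a b : 'I_m) (x : 'rV[R]_m) : 'rV[R]_n :=
  \row_k (partial a (partial b F) x 0 k +
    \sum_i \sum_j christoffel h k i j (F x) *
      partial a F x 0 i * partial b F x 0 j).

Definition second_form (m n : nat) (h : 'rV[R]_n -> 'M[R]_n)
    (F : 'rV[R]_m -> 'rV[R]_n) (nu : 'rV[R]_n) (x : 'rV[R]_m) : 'M[R]_m :=
  \matrix_(a, b) metric_dot (h (F x)) (cov_partial h F a b x) nu.

Definition mean_curvature (n : nat) (h : 'rV[R]_n -> 'M[R]_n)
    (F : 'rV[R]_2 -> 'rV[R]_n) (nu : 'rV[R]_n) (x : 'rV[R]_2) : R :=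
  2^-1 * \tr (invmx (pullback h F x) *m second_form h F nu x).

(* Index arithmetic is modulo 3.  The cross product for [dmu2 x] is a positive
   multiple of this Euclidean one, so that it has the same direction. *)
Definition cross (v w : 'rV[R]_3) : 'rV[R]_3 :=
  \row_(k < 3) (v 0 (k + 1) * w 0 (k + 2%:R) - v 0 (k + 2%:R) * w 0 (k + 1)).

Definition local_normal (F : 'rV[R]_2 -> 'rV[R]_3) (x : 'rV[R]_2) : 'rV[R]_3 :=
  let c := cross (partial 0 F x) (partial 1 F x) in
  (Num.sqrt (metric_dot (dmu2 (F x)) c c))^-1 *: c.

(* f_z = (f_u - i f_v) / 2.  The generic ['i] of a numClosedFieldType is only
   specified up to sign, hence the explicit [0 +i* 1]. *)
Definition partial_z (f : 'rV[R]_2 -> R[i]) (x : 'rV[R]_2) : R[i] :=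
  let d a := partial a (fun y => complex.Re (f y)) x
             +i* partial a (fun y => complex.Im (f y)) x in
  (d 0 - (0 +i* 1) * d 1) / 2%:R.

Definition antiholomorphic_at (f : 'rV[R]_2 -> R[i]) (x : 'rV[R]_2) : Prop :=
  [/\ differentiable (fun y => complex.Re (f y)) x,
      differentiable (fun y => complex.Im (f y)) x &
      partial_z f x = 0].

(* [R[i]^o] is [R[i]] with its usual topology. *)
Definition riemann_sphere := one_point_compactification R[i]^o.

(* Stereographic projection from the south pole. *)
Definition stereo (a : 'rV[R]_3) : riemann_sphere :=
  if a 0 2%:R == -1 then None
  else Some ((a 0 0 +i* a 0 1) / (1 + a 0 2%:R)%:C).

(* The two standard coordinates w and 1/w of the Riemann sphere, with a dummy
   value where they are not defined. *)
Definition sphere_coord (w : riemann_sphere) : R[i] :=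
  if w is Some c then c else 0.
Definition sphere_coord_inv (w : riemann_sphere) : R[i] :=
  if w is Some c then c^-1 else 0.

End LocalGeometry.

Section Surface.
Variables (R : realType) (T : topologicalType) (S : riemannian_surface R T).

Definition conformal_immersion (X : T -> 'rV[R]_3) : Prop :=
  (forall p, X p != 0) /\
  forall i : chart_index S,
    smooth_on (chart_img i) (X \o param i) /\
    forall z, chart_img i z ->
      row_free ('J (X \o param i) z) /\
      exists2 c, 0 < c &
        pullback (@dmu2 R) (X \o param i) z = c *: surf_metric i z.

(* The vector [N p] is given by its coordinates in the basis d/dx_j. *)
Definition unit_normal (X N : T -> 'rV[R]_3) : Prop :=
  forall (i : chart_index S) z, chart_img i z ->
    N (param i z) = local_normal (X \o param i) z.

Definition minimal (X : T -> 'rV[R]_3) : Prop :=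
  forall (i : chart_index S) z, chart_img i z ->
    mean_curvature (@dmu2 R) (X \o param i)
      (local_normal (X \o param i) z) z = 0.

(* As the frame is orthonormal, the coefficients N_j of N in it are the inner
   products with the E_j. *)
Definition gauss_map (X N : T -> 'rV[R]_3) (p : T) : riemann_sphere R :=
  stereo (\row_j metric_dot (dmu2 (X p)) (N p) (frame j (X p))).

Definition antiholomorphic (g : T -> riemann_sphere R) : Prop :=
  continuous g /\
  forall (i : chart_index S) z, chart_img i z ->
    (g (param i z) <> None ->
       antiholomorphic_at (@sphere_coord R \o g \o param i) z) /\
    (g (param i z) <> Some 0 ->
       antiholomorphic_at (@sphere_coord_inv R \o g \o param i) z).

End Surface.

(* Main.v *)
Require Import Defs.
From mathcomp Require Import all_boot all_order all_algebra.
From mathcomp Require Import complex ring lra.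
From mathcomp Require Import all_classical all_reals all_analysis.
Set Implicit Arguments.
Unset Strict Implicit.
Unset Printing Implicit Defensive.
Import Order.TTheory GRing.Theory Num.Theory.
Import numFieldNormedType.Exports.
Local Open Scope classical_set_scope.
Local Open Scope ring_scope.

(** The metric of the target is conformal to the Euclidean one, so [X] is also a
    conformal immersion into Euclidean space, and its Gauss map is the Euclidean
    one: [nu], the unit vector along [X_u x X_v], read through stereographic
    projection.  Three facts then exclude a non-constant anti-holomorphic [g].

    Since the projection from the south pole preserves the orientation given by
    the outer normal of the sphere, [g] is anti-holomorphic exactly when the
    differential of [nu], as an endomorphism of the tangent plane, is
    traceless; that is, when the Euclidean mean curvature vanishes
    ([antiholomorphic_trace0]).

    Under the conformal change with factor [|x|^-2], minimality says that the
    Euclidean mean curvature is [- (X . nu) / |X|^2] ([minimal_dmu2]).  With the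
    first fact, [X . nu = 0]: the surface is a cone with vertex 0.

    Differentiating [X . nu = 0], and using that [X_u], [X_v] are orthogonal to
    [nu], gives [X . nu_u = X . nu_v = 0].  As [g] is anti-conformal, [nu_u] and
    [nu_v] are orthogonal and of the same length, so if they do not vanish then
    [nu], [nu_u], [nu_v] form a basis and [X = 0], which is excluded
    ([antiholomorphic_normal_to]).  Hence [nu] is locally constant, and constant
    because the surface is connected.

    In the computations [nu] is replaced by a positive multiple of it that is a
    polynomial in the real and imaginary parts of [g], or of [1 / g] where
    [g] is infinite; a sign [s] treats the two coordinates at once.  All vector
    identities are then polynomial, and the differentiability of this
    representative is part of the hypothesis on [g]. *)

(** * Euclidean vectors and the direction given by a stereographic coordinate *)

Section EuclideanAlgebra.
Variable R : realType.
Implicit Types (u v w : 'rV[R]_3) (s a b k p q : R).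

Definition dot u v : R := \sum_i u 0 i * v 0 i.

Lemma ord2P (i : 'I_2) : i = 0 \/ i = 1.
Proof. by case: i => -[|[|//]] lti; [left|right]; apply: val_inj. Qed.

Lemma ord3P (i : 'I_3) : [\/ i = 0, i = 1 | i = 2%:R].
Proof.
by case: i => -[|[|[|//]]] lti; [constructor 1|constructor 2|constructor 3];
  apply: val_inj.
Qed.

Lemma sum3E (f : 'I_3 -> R) : \sum_i f i = f 0 + f 1 + f 2%:R.
Proof.
rewrite !big_ord_recl big_ord0 addr0 addrA.
by congr (_ + f _ + f _); apply: val_inj.
Qed.

Lemma sum2E (f : 'I_2 -> R) : \sum_i f i = f 0 + f 1.
Proof.
rewrite !big_ord_recl big_ord0 addr0.
by congr (_ + f _); apply: val_inj.
Qed.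

Lemma dotE u v : dot u v = u 0 0 * v 0 0 + u 0 1 * v 0 1 + u 0 2%:R * v 0 2%:R.
Proof. exact: sum3E. Qed.

Lemma rV3P u v :
  u 0 0 = v 0 0 -> u 0 1 = v 0 1 -> u 0 2%:R = v 0 2%:R -> u = v.
Proof.
by move=> e0 e1 e2; apply/rowP => k; case: (ord3P k) => ->.
Qed.

Lemma crossE u v :
  [/\ cross u v 0 0 = u 0 1 * v 0 2%:R - u 0 2%:R * v 0 1,
      cross u v 0 1 = u 0 2%:R * v 0 0 - u 0 0 * v 0 2%:R &
      cross u v 0 2%:R = u 0 0 * v 0 1 - u 0 1 * v 0 0].
Proof.
have e10 : 1 + 2%:R = 0 :> 'I_3 by apply: val_inj.
have e11 : 1 + 1 = 2%:R :> 'I_3 by apply: val_inj.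
have e21 : 2%:R + 1 = 0 :> 'I_3 by apply: val_inj.
have e22 : 2%:R + 2%:R = 1 :> 'I_3 by apply: val_inj.
by rewrite !mxE !add0r e10 e11 e21 e22.
Qed.

Lemma dotC u v : dot u v = dot v u.
Proof. by rewrite !dotE; ring. Qed.

Lemma dotDl u v w : dot (u + v) w = dot u w + dot v w.
Proof. by rewrite !dotE !mxE; ring. Qed.

Lemma dotZl k u v : dot (k *: u) v = k * dot u v.
Proof. by rewrite !dotE !mxE; ring. Qed.

Lemma dotZr k u v : dot u (k *: v) = k * dot u v.
Proof. by rewrite dotC dotZl dotC. Qed.

Lemma dot_delta u (k : 'I_3) : dot u (delta_mx 0 k) = u 0 k.
Proof.
rewrite /dot (bigD1 k)//= big1 => [|l lk]; rewrite !mxE !eqxx ?mulr1 ?addr0//=.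
by rewrite (negbTE lk) mulr0.
Qed.

Lemma dot_ge0 u : 0 <= dot u u.
Proof. by rewrite dotE -!expr2 !addr_ge0 ?sqr_ge0. Qed.

Lemma dot_gt0 u : (0 < dot u u) = (u != 0).
Proof.
rewrite lt0r dot_ge0 andbT; congr (~~ _); apply/idP/eqP => [|->]; last first.
  by rewrite dotE !mxE !mul0r !addr0.
rewrite dotE -!expr2 !paddr_eq0 ?addr_ge0 ?sqr_ge0// !sqrf_eq0.
by move=> /andP[/andP[/eqP u0 /eqP u1] /eqP u2]; apply: rV3P; rewrite !mxE.
Qed.

Lemma dot_crossl u v : dot u (cross u v) = 0.
Proof. by have [c0 c1 c2] := crossE u v; rewrite dotE c0 c1 c2; ring. Qed.

Lemma dot_crossr u v : dot v (cross u v) = 0.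
Proof. by have [c0 c1 c2] := crossE u v; rewrite dotE c0 c1 c2; ring. Qed.

Lemma dot_cross u v :
  dot (cross u v) (cross u v) = dot u u * dot v v - dot u v ^+ 2.
Proof. by have [c0 c1 c2] := crossE u v; rewrite !dotE c0 c1 c2; ring. Qed.

Lemma cross_neq0_dotl u v : cross u v != 0 -> dot u u != 0.
Proof.
rewrite -dot_gt0 dot_cross; apply: contraTneq => ->.
by rewrite mul0r sub0r -leNgt oppr_le0 sqr_ge0.
Qed.

Lemma cross_conformal_neq0 u v k : 0 < k ->
  dot u u = k -> dot v v = k -> dot u v = 0 -> cross u v != 0.
Proof.
move=> k0 uu vv uv; rewrite -dot_gt0 dot_cross uu vv uv.
by rewrite expr0n subr0 mulr_gt0.
Qed.

(** Inverse stereographic projection of [a + i b] without its denominator: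
    this vector is [1 + a ^+ 2 + b ^+ 2] times the point of the unit sphere.
    For [s = 1] the projection is from the south pole; for [s = -1] the formula
    is the previous one rotated by a half turn about the first axis, the motion
    of the sphere that inverts the coordinate, so that [a + i b] is then the
    inverse of the usual coordinate of the point. *)
Definition sphere_dir s a b : 'rV[R]_3 :=
  \row_k [:: 2 * a; 2 * s * b; s * (1 - a ^+ 2 - b ^+ 2)]`_k.

Definition d_sphere_dir s a b p q : 'rV[R]_3 :=
  \row_k [:: 2 * p; 2 * s * q; - 2 * s * (a * p + b * q)]`_k.

(** An anti-conformal differential of the Gauss map is traceless.  Here [u], [v]
    stand for [X_u], [X_v], and the pairs [(p, q)], [(q, - p)] are the values
    that the equation [g_z = 0] gives to the derivatives of [(a, b)] with respect
    to the two conformal parameters.  Writing [W] for the direction and [W_u],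
    [W_v] for its derivatives, both [(u, v)] and [(W_u, W_v)] are, up to
    multiples of [W], orthogonal pairs of equal lengths, but with opposite
    orientations; so turning the second term by a right angle makes it cancel
    the first one.  The sign condition on [k] fixes the orientation and cannot
    be reversed. *)
Lemma antiholomorphic_trace0 s a b p q k u v :
    s = 1 \/ s = -1 -> 0 < k -> dot u u = dot v v -> dot u v = 0 ->
    sphere_dir s a b = k *: cross u v ->
  dot u (d_sphere_dir s a b p q) + dot v (d_sphere_dir s a b q (- p)) = 0.
Proof.
move=> s1 k0 uuvv uv0 Wc.
have uW : dot u (sphere_dir s a b) = 0 by rewrite Wc dotZr dot_crossl mulr0.
have ss : s ^+ 2 = 1 by case: s1 => ->; rewrite ?sqrrN expr1n.
have m0 : 0 < 1 + a ^+ 2 + b ^+ 2 by rewrite !ltr_wpDr ?sqr_ge0.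
have normW : 1 + a ^+ 2 + b ^+ 2 = k * dot u u.
  apply/eqP; rewrite -(@eqrXn2 _ 2) ?mulr_ge0 ?dot_ge0 ?(ltW k0) ?(ltW m0)//.
  apply/eqP; transitivity (dot (sphere_dir s a b) (sphere_dir s a b)).
    rewrite dotE !mxE /=; ring: ss.
  by rewrite Wc dotZl dotZr dot_cross -uuvv uv0; ring.
have [c0 c1 c2] := crossE u v.
have e0 : 2 * a = k * (u 0 1 * v 0 2%:R - u 0 2%:R * v 0 1).
  by move/rowP: (Wc) => /(_ 0); rewrite !mxE /=; move: c0; rewrite mxE => ->.
have e1 : 2 * s * b = k * (u 0 2%:R * v 0 0 - u 0 0 * v 0 2%:R).
  by move/rowP: (Wc) => /(_ 1); rewrite !mxE /=; move: c1; rewrite mxE => ->.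
have e2 : s * (1 - a ^+ 2 - b ^+ 2) = k * (u 0 0 * v 0 1 - u 0 1 * v 0 0).
  by move/rowP: (Wc) => /(_ 2%:R); rewrite !mxE /=; move: c2; rewrite mxE => ->.
set m := 1 + _ + _ in normW m0.
(* [v] is [u] turned by a right angle about [W]: [W x u = |W| v]. *)
have rot0 : m * v 0 0 =
    (2 * s * b) * u 0 2%:R - s * (1 - a ^+ 2 - b ^+ 2) * u 0 1.
  rewrite normW e1 e2.
  transitivity (k * (dot u u * v 0 0 - u 0 0 * dot u v)).
    by rewrite uv0; ring.
  by rewrite !dotE; ring.
have rot1 : m * v 0 1 =
    s * (1 - a ^+ 2 - b ^+ 2) * u 0 0 - 2 * a * u 0 2%:R.
  rewrite normW e0 e2.
  transitivity (k * (dot u u * v 0 1 - u 0 1 * dot u v)).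
    by rewrite uv0; ring.
  by rewrite !dotE; ring.
have rot2 : m * v 0 2%:R = 2 * a * u 0 1 - (2 * s * b) * u 0 0.
  rewrite normW e0 e1.
  transitivity (k * (dot u u * v 0 2%:R - u 0 2%:R * dot u v)).
    by rewrite uv0; ring.
  by rewrite !dotE; ring.
apply: (mulfI (lt0r_neq0 m0)); rewrite mulr0 mulrDr.
(* The component of [W_u] along [W] survives the rotation, with a factor that
   is the derivative of [m]. *)
transitivity (2 * (a * p + b * q) * dot u (sphere_dir s a b)).
  2: by rewrite uW mulr0.
rewrite !dotE !mxE /= [m * (v 0 0 * _ + _ + _)]mulrDr.
rewrite [m * (v 0 0 * _ + _)]mulrDr.
rewrite !(mulrA m (v _ _)) rot0 rot1 rot2 /m.
by case: s1 => ->; ring.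
Qed.

(** The direction and its two derivatives are linearly independent unless the
    derivatives vanish, because an anti-conformal differential has rank 0 or 2.
    So no nonzero vector is orthogonal to all three. *)
Lemma antiholomorphic_normal_to s a b p q w :
    s = 1 \/ s = -1 -> w != 0 ->
    dot w (sphere_dir s a b) = 0 -> dot w (d_sphere_dir s a b p q) = 0 ->
    dot w (d_sphere_dir s a b q (- p)) = 0 ->
  p = 0 /\ q = 0.
Proof.
move=> s1 w0 wW wWu wWv.
have [|D0] := eqVneq (p ^+ 2 + q ^+ 2) 0.
  move/eqP; rewrite paddr_eq0 ?sqr_ge0// !sqrf_eq0.
  by move=> /andP[/eqP-> /eqP->].
have two0 : 2 != 0 :> R by rewrite pnatr_eq0.
have m0 : 1 + a ^+ 2 + b ^+ 2 != 0.
  by rewrite lt0r_neq0// !ltr_wpDr ?sqr_ge0.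
move: wW wWu wWv; rewrite !dotE !mxE /= => wW wWu wWv.
(* The combinations [p W_u + q W_v] and [q W_u - p W_v] decouple the first two
   coordinates. *)
have w0E : w 0 0 = s * a * w 0 2%:R.
  apply: (mulfI D0); apply: (mulfI two0); apply/eqP.
  rewrite -subr_eq0; apply/eqP.
  transitivity (p * 0 + q * 0); last by ring.
  by rewrite -{1}wWu -wWv; ring.
have w1E : w 0 1 = b * w 0 2%:R.
  apply: (mulfI D0); apply: (mulfI two0); apply/eqP.
  rewrite -subr_eq0; apply/eqP.
  transitivity (s * (q * 0 - p * 0)); last by ring.
  by rewrite -{1}wWu -wWv; case: s1 => ->; ring.
have w2 : w 0 2%:R = 0.
  apply: (mulfI m0); rewrite mulr0 -(mulr0 s) -wW w0E w1E.
  by case: s1 => ->; ring.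
case/eqP: w0; apply: rV3P; rewrite ?w0E ?w1E w2 mxE; ring.
Qed.

End EuclideanAlgebra.

(** * Derivatives of directions, and the local argument *)

Section Derivatives.
Variables (R : realType) (V : normedModType R).
Implicit Types (F G : V -> 'rV[R]_3) (f : V -> R) (x v : V).

Lemma is_derive_coord F x v k :
  derivable F x v -> is_derive x v (fun y => F y 0 k) ('D_v F x 0 k).
Proof.
move=> dF; rewrite derive_mx// mxE; apply: derivableP.
by move/derivable_mxP: dF.
Qed.

Lemma is_derive_dot F G x v : derivable F x v -> derivable G x v ->
  is_derive x v (fun y => dot (F y) (G y))
    (dot ('D_v F x) (G x) + dot (F x) ('D_v G x)).
Proof.
move=> dF dG.
have -> : (fun y => dot (F y) (G y)) =
    \sum_i ((fun y => F y 0 i) * (fun y => G y 0 i)).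
  by apply/funext => y; rewrite fct_sumE.
have dFk k := is_derive_coord k dF; have dGk k := is_derive_coord k dG.
apply: is_derive_eq.
rewrite addrC -big_split; apply: eq_bigr => i _.
by rewrite /GRing.scale /=; ring.
Qed.

Lemma is_derive_sphere_dir s (a b : V -> R) x v p q :
  is_derive x v a p -> is_derive x v b q ->
  is_derive x v (fun y => sphere_dir s (a y) (b y))
    (d_sphere_dir s (a x) (b x) p q).
Proof.
move=> da db.
have D i k : is_derive x v (fun y => sphere_dir s (a y) (b y) i k)
    (d_sphere_dir s (a x) (b x) p q i k).
  rewrite /d_sphere_dir mxE; case: k => -[|[|[|//]]] lti /=.
  - have -> : (fun y => sphere_dir s (a y) (b y) i (Ordinal lti)) = 2 *: a.
      by apply/funext => y; rewrite mxE.
    by apply: is_derive_eq.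
  - have -> : (fun y => sphere_dir s (a y) (b y) i (Ordinal lti))
        = (2 * s) *: b.
      by apply/funext => y; rewrite mxE.
    by apply: is_derive_eq.
  - have -> : (fun y => sphere_dir s (a y) (b y) i (Ordinal lti))
        = s *: (cst 1 - a ^+ 2 - b ^+ 2).
      by apply/funext => y; rewrite mxE.
    apply: is_derive_eq; rewrite /GRing.scale /= !expr1; ring.
have dW : derivable (fun y => sphere_dir s (a y) (b y)) x v.
  by apply/derivable_mxP => i k; apply: ex_derive.
apply: DeriveDef => //; rewrite derive_mx//; apply/matrixP => i k.
by rewrite mxE; apply: derive_val.
Qed.

End Derivatives.

Lemma near_derive0 (R : realType) (V : normedModType R) (f : V -> R) x v df :
  is_derive x v f df -> (\forall y \near x, f y = 0) -> df = 0.
Proof.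
move=> [_ <-] f0; rewrite (@near_eq_derive _ _ _ _ (cst 0))//.
exact: derive_val.
Qed.

(** The local heart of the proof, for a conformal parametrization [F] whose
    normal points along [W = sphere_dir s a b].  Differentiating [F_u . W = 0]
    and [F_v . W = 0] turns tracelessness of the differential of [W] into
    [(F_uu + F_vv) . W = 0]; the equation of minimal surfaces then leaves
    [F . W = 0].  Differentiating once more, [F] is orthogonal to [W] and to its
    two derivatives, which must therefore vanish. *)
Lemma minimal_antiholomorphic_critical (R : realType) (F : 'rV[R]_2 -> 'rV[R]_3)
    (U : set 'rV[R]_2) (s : R) (a b k : 'rV[R]_2 -> R) :
  open U -> s = 1 \/ s = -1 ->
  (forall z, U z -> F z != 0) ->
  (forall z, U z -> differentiable F z) ->
  (forall i z, U z -> differentiable (partial i F) z) ->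
  (forall z, U z -> dot (partial 0 F z) (partial 0 F z) =
                    dot (partial 1 F z) (partial 1 F z)) ->
  (forall z, U z -> dot (partial 0 F z) (partial 1 F z) = 0) ->
  (forall z, U z -> cross (partial 0 F z) (partial 1 F z) != 0) ->
  (forall z, U z ->
     dot (partial 0 (partial 0 F) z + partial 1 (partial 1 F) z)
         (cross (partial 0 F z) (partial 1 F z)) +
     2 * dot (partial 0 F z) (partial 0 F z) / dot (F z) (F z) *
       dot (F z) (cross (partial 0 F z) (partial 1 F z)) = 0) ->
  (forall z, U z -> 0 < k z /\ sphere_dir s (a z) (b z) =
     k z *: cross (partial 0 F z) (partial 1 F z)) ->
  (forall z, U z -> differentiable a z /\ differentiable b z) ->
  (forall z, U z -> partial 0 a z = - partial 1 b z /\
                    partial 0 b z = partial 1 a z) ->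
  forall z, U z -> partial 0 a z = 0 /\ partial 0 b z = 0.
Proof.
move=> oU s1 F0 dF ddF iso orth c0 minF Wc dab cr.
pose W y := sphere_dir s (a y) (b y).
have nearU z : U z -> \forall y \near z, U y by move=> ?; apply: open_nbhs_nbhs.
have WP i z : U z -> dot (partial i F z) (W z) = 0.
  move=> Uz; rewrite /W (Wc _ Uz).2 dotZr.
  by case: (ord2P i) => ->; [rewrite dot_crossl mulr0|rewrite dot_crossr mulr0].
have dW0 z : U z -> is_derive z (delta_mx 0 0) W
    (d_sphere_dir s (a z) (b z) (partial 0 a z) (partial 0 b z)).
  move=> Uz; have [da db] := dab _ Uz.
  by apply: is_derive_sphere_dir; apply: derivableP; apply: diff_derivable.
have dW1 z : U z -> is_derive z (delta_mx 0 1) W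
    (d_sphere_dir s (a z) (b z) (partial 0 b z) (- partial 0 a z)).
  move=> Uz; have [da db] := dab _ Uz; have [-> ->] := cr _ Uz; rewrite opprK.
  by apply: is_derive_sphere_dir; apply: derivableP; apply: diff_derivable.
have dFW i z : U z -> is_derive z (delta_mx 0 i) W ('D_(delta_mx 0 i) W z).
  move=> Uz; have [da db] := dab _ Uz; apply: derivableP.
  apply: ex_derive; apply: is_derive_sphere_dir;
    apply: derivableP; exact: diff_derivable.
have lapW z : U z ->
    dot (partial 0 (partial 0 F) z + partial 1 (partial 1 F) z) (W z) = 0.
  move=> Uz.
  have E i : dot (partial i (partial i F) z) (W z) +
      dot (partial i F z) ('D_(delta_mx 0 i) W z) = 0.
    apply: (@near_derive0 _ _ (fun y => dot (partial i F y) (W y))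
              z (delta_mx 0 i)).
      apply: is_derive_dot; first exact/diff_derivable/ddF.
      by have [] := dFW i _ Uz.
    by near=> y; apply: WP; near: y; exact: nearU.
  have := E 0; have := E 1.
  have [_ ->] := dW0 z Uz; have [_ ->] := dW1 z Uz.
  have [k0 kE] := Wc _ Uz.
  have := antiholomorphic_trace0 (partial 0 a z) (partial 0 b z) s1 k0
    (iso z Uz) (orth z Uz) kE.
  rewrite dotDl.
  move=> tr0 E1 E0; move: (congr2 +%R E0 E1).
  by rewrite addr0 addrACA [X in _ + X]tr0 addr0.
have FW z : U z -> dot (F z) (W z) = 0.
  move=> Uz; have := lapW z Uz; have := minF z Uz; have [k0 kE] := Wc _ Uz.
  rewrite /W kE !dotZr => + /eqP; rewrite mulf_eq0 gt_eqF//= => + /eqP lap0.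
  rewrite lap0 add0r => /eqP; rewrite mulf_eq0 => /orP[|/eqP->].
    2: by rewrite mulr0.
  have uu0 : dot (partial 0 F z) (partial 0 F z) != 0.
    exact: cross_neq0_dotl (c0 z Uz).
  rewrite !mulf_eq0 invr_eq0 pnatr_eq0 (negbTE uu0)/=.
  by rewrite (gt_eqF (_ : 0 < _)) ?dot_gt0 ?F0.
move=> z Uz.
have FdW i : dot (F z) ('D_(delta_mx 0 i) W z) = 0.
  rewrite -[LHS]add0r -[X in X + _](WP i z Uz).
  apply: (@near_derive0 _ _ (fun y => dot (F y) (W y)) z (delta_mx 0 i)).
    apply: is_derive_dot; first exact/diff_derivable/dF.
    by have [] := dFW i _ Uz.
  by near=> y; apply: FW; near: y; exact: nearU.
apply: (antiholomorphic_normal_to s1 (F0 z Uz) (FW z Uz)).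
  by rewrite -(FdW 0); have [_ ->] := dW0 z Uz.
by rewrite -(FdW 1); have [_ ->] := dW1 z Uz.
Unshelve. all: by end_near. Qed.

(** By the mean value theorem on the segment from [x] to [y], which stays in the
    ball. *)
Lemma partial0_constant (R : realType) (n : nat) (f : 'rV[R]_n -> R)
    (x : 'rV[R]_n) (r : R) :
  (forall y, ball x r y -> differentiable f y) ->
  (forall i y, ball x r y -> partial i f y = 0) ->
  forall y, ball x r y -> f y = f x.
Proof.
move=> df pf y xy.
have inB t : t \in `[0, 1]%R -> ball x r (x + t *: (y - x)).
  rewrite in_itv /= => /andP[t0 t1]; move: xy; rewrite -!ball_normE /=.
  rewrite opprD addNKr normrN normrZ -(normrN (x - y)) opprB ger0_norm//.
  by apply: le_lt_trans; rewrite ler_piMl.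
have Df t : t \in `[0, 1]%R ->
    is_derive (x + t *: (y - x)) (y - x) f 0.
  move=> /inB Bt; have dft := df _ Bt; split; first exact: diff_derivable.
  move: (_ + _ : 'rV[R]_n) Bt dft => z Bz dfz.
  rewrite deriveE//.
  rewrite (row_sum_delta (y - x)) linear_sum big1// => i _.
  rewrite linearZ /= -deriveE//; move: (pf i z Bz); rewrite /partial => ->.
  by rewrite scaler0.
pose g (t : R) : R := f (x + t *: (y - x)).
have Dg (t : R) : t \in `[0, 1]%R -> is_derive t (1 : R) g 0.
  have shiftE : (fun h : R => h^-1 *: ((g \o shift t) (h *: (1 : R)) - g t)) =
      (fun h => h^-1 *: ((f \o shift (x + t *: (y - x))) (h *: (y - x))
                          - f (x + t *: (y - x)))).
    apply/funext => h; rewrite /g /=; congr (_ *: (f _ - _)).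
    by rewrite [h *: 1]mulr1 scalerDl addrCA.
  by move=> /Df[d1 e1]; split; rewrite /derivable /derive shiftE.
have gc : {within `[0 : R, 1], continuous g}.
  apply: derivable_within_continuous => t t01.
  by have [] := Dg t t01.
have gd t : t \in `]0 : R, 1[ -> is_derive t (1 : R) g ((fun=> 0) t).
  by move=> t01; apply: Dg; apply: subset_itvW t01.
have le01 : (0 : R) <= 1 by exact: ler01.
have [t _] := MVT_segment le01 gd gc.
rewrite /g mul0r scale1r scale0r addr0 [x + _]addrC subrK.
by move=> /subr0_eq.
Qed.

(** * Conformality, mean curvature and normals for the metric |x|^-2 |dx|^2 *)

Section ConformalMetric.
Variable R : realType.
Implicit Types (x u v c : 'rV[R]_3) (F : 'rV[R]_2 -> 'rV[R]_3).

Lemma enorm_sqr x : enorm x ^+ 2 = dot x x.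
Proof.
by rewrite sqr_sqrtr ?sumr_ge0// => i _; rewrite sqr_ge0.
Qed.

Lemma enorm_gt0 x : x != 0 -> 0 < enorm x.
Proof.
by move=> x0; rewrite lt0r sqrtr_ge0 andbT -sqrf_eq0 enorm_sqr gt_eqF ?dot_gt0.
Qed.

Lemma dmu2E x : dmu2 x = (dot x x)^-1%:M.
Proof. by rewrite /dmu2 enorm_sqr. Qed.

Lemma metric_dot_dmu2 x u v : metric_dot (dmu2 x) u v = (dot x x)^-1 * dot u v.
Proof.
rewrite /metric_dot dmu2E mul_mx_scalar -scalemxAl mxE; congr (_ * _).
by rewrite mxE; apply: eq_bigr => i _; rewrite mxE.
Qed.

Lemma partial_dmu2 i j l x : x != 0 ->
  partial i (fun y => dmu2 y j l) x =
    (- 2 * x 0 i / dot x x ^+ 2) *+ (j == l).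
Proof.
move=> x0; have rx0 : dot x x != 0 by rewrite gt_eqF ?dot_gt0.
have -> : (fun y : 'rV[R]_3 => dmu2 y j l)
    = (fun y => (dot y y)^-1 *+ (j == l)).
  by apply: funext => y; rewrite dmu2E mxE.
case: (j == l); last by rewrite !mulr0n; exact: derive_cst.
rewrite !mulr1n.
have dx : derivable id x (delta_mx 0 i) by exact: derivable_id.
have [dr re] := is_derive_dot dx dx.
rewrite /partial (@deriveV _ _ (fun y => dot y y) x)// re derive_id.
by rewrite (dotC (delta_mx 0 i)) !dot_delta /GRing.scale /= ; field.
Qed.

Lemma christoffel_dmu2 k i j x : x != 0 ->
  christoffel (@dmu2 R) k i j x =
    - (dot x x)^-1 *
      (x 0 i *+ (k == j) + x 0 j *+ (k == i) - x 0 k *+ (i == j)).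
Proof.
move=> x0; have rx0 : dot x x != 0 by rewrite gt_eqF ?dot_gt0.
rewrite /christoffel dmu2E invmx_scalar invrK (bigD1 k)//= big1 ?addr0.
  2: by move=> l lk; rewrite mxE eq_sym (negbTE lk) mul0r.
rewrite !partial_dmu2// mxE eqxx mulr1n (eq_sym k j) (eq_sym k i).
by case: (j == k); case: (i == k); case: (i == j);
  rewrite ?mulr1n ?mulr0n; field.
Qed.

(** The usual correction to the second derivatives under the conformal change
    with factor [|x|^-2]: against a normal vector only the term along the
    gradient of the factor, which is radial, remains. *)
Lemma cov_partial_dmu2_dot F a z c : F z != 0 ->
  dot (partial a F z) c = 0 ->
  dot (cov_partial (@dmu2 R) F a a z) c =
    dot (partial a (partial a F) z) c
    + dot (partial a F z) (partial a F z) / dot (F z) (F z) * dot (F z) c.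
Proof.
move=> F0 pc0; set p := partial a F z in pc0 *; set x := F z in F0 *.
set q := partial a _ z.
have E k : cov_partial (@dmu2 R) F a a z 0 k =
    q 0 k - (dot x x)^-1 * (2 * p 0 k * dot x p - x 0 k * dot p p).
  rewrite mxE -/q; congr (_ + _); rewrite -/p -/x.
  under eq_bigr do under eq_bigr do rewrite christoffel_dmu2//.
  rewrite !sum3E !dotE.
  have [->|->|->] := ord3P k.
  - by rewrite /= ?mulr1n ?mulr0n; ring.
  - by rewrite /= ?mulr1n ?mulr0n; ring.
  - by rewrite /= ?mulr1n ?mulr0n; ring.
have {}E : cov_partial (@dmu2 R) F a a z =
    q + (dot p p / dot x x) *: x - (2 * dot x p / dot x x) *: p.
  by apply/rowP => k; rewrite E !mxE; ring.
by rewrite E dotDl dotDl -scaleNr !dotZl pc0; ring.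
Qed.

(** With the Euclidean normal [c = F_u x F_v], minimality for the conformal metric
    becomes [(Laplacian F) . c + 2 |F_u|^2 / |F|^2 (F . c) = 0].  In particular
    the spheres centred at 0 are solutions, as are the cones over geodesics of
    the unit sphere. *)
Lemma minimal_dmu2 F z mu : F z != 0 -> 0 < mu ->
    pullback (@dmu2 R) F z = mu%:M ->
    cross (partial 0 F z) (partial 1 F z) != 0 ->
    dot (partial 0 F z) (partial 0 F z) = dot (partial 1 F z) (partial 1 F z) ->
    mean_curvature (@dmu2 R) F (local_normal F z) z = 0 ->
  dot (partial 0 (partial 0 F) z + partial 1 (partial 1 F) z)
      (cross (partial 0 F z) (partial 1 F z)) +
  2 * dot (partial 0 F z) (partial 0 F z) / dot (F z) (F z) *
    dot (F z) (cross (partial 0 F z) (partial 1 F z)) = 0.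
Proof.
move=> F0 mu0 pb.
rewrite /mean_curvature pb invmx_scalar mul_scalar_mx mxtraceZ.
rewrite /local_normal.
have pc0 := dot_crossl (partial 0 F z) (partial 1 F z).
have pc1 := dot_crossr (partial 0 F z) (partial 1 F z).
move: pc0 pc1; set c := cross _ _ => pc0 pc1 c0 iso.
have rx0 : dot (F z) (F z) != 0 by rewrite gt_eqF ?dot_gt0.
have : 0 < Num.sqrt (metric_dot (dmu2 (F z)) c c).
  by rewrite sqrtr_gt0 metric_dot_dmu2 mulr_gt0 ?invr_gt0 ?dot_gt0.
move: (Num.sqrt _) => n n0.
have II a : dot (partial a F z) c = 0 ->
    second_form (@dmu2 R) F (n^-1 *: c) z a a = (dot (F z) (F z))^-1 * (n^-1 *
      (dot (partial a (partial a F) z) c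
       + dot (partial a F z) (partial a F z) / dot (F z) (F z) * dot (F z) c)).
  by move=> ?; rewrite mxE metric_dot_dmu2 dotZr cov_partial_dmu2_dot.
have solve (q0 q1 : 'rV[R]_3) (p0 p1 h0 h1 r : R) : r != 0 -> p0 = p1 ->
    h0 = r^-1 * (n^-1 * (dot q0 c + p0 / r * dot (F z) c)) ->
    h1 = r^-1 * (n^-1 * (dot q1 c + p1 / r * dot (F z) c)) ->
    2^-1 * (mu^-1 * (h0 + h1)) = 0 ->
    dot (q0 + q1) c + 2 * p0 / r * dot (F z) c = 0.
  move: (gt_eqF n0) (gt_eqF mu0) => /negbT n'0 /negbT mu'0 r0 -> -> -> H0.
  transitivity (2 * mu * r * n * 0 : R); last by rewrite mulr0.
  by rewrite -H0 dotDl; field; rewrite r0 n'0 mu'0.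
rewrite /mxtrace sum2E; exact: solve rx0 iso (II 0 pc0) (II 1 pc1).
Qed.

Lemma pullback_dmu2 F z i j : differentiable F z ->
  pullback (@dmu2 R) F z i j =
    (dot (F z) (F z))^-1 * dot (partial i F z) (partial j F z).
Proof.
move=> dF; rewrite /pullback dmu2E mul_mx_scalar -scalemxAl mxE; congr (_ * _).
rewrite mxE; apply: eq_bigr => k _; rewrite mxE /partial !deriveEjacobian//.
by rewrite -!rowE !mxE.
Qed.

Lemma conformal_partials F z mu : F z != 0 -> differentiable F z -> 0 < mu ->
    pullback (@dmu2 R) F z = mu%:M ->
  [/\ dot (partial 0 F z) (partial 0 F z) = dot (partial 1 F z) (partial 1 F z),
      dot (partial 0 F z) (partial 1 F z) = 0 &
      cross (partial 0 F z) (partial 1 F z) != 0].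
Proof.
move=> F0 dF mu0 pb.
have rx0 : 0 < dot (F z) (F z) by rewrite dot_gt0.
have E i j : dot (partial i F z) (partial j F z) =
    dot (F z) (F z) * (mu *+ (i == j)).
  have := pullback_dmu2 i j dF; rewrite pb mxE => ->.
  by rewrite mulVKf// gt_eqF.
have e00 : dot (partial 0 F z) (partial 0 F z) = dot (F z) (F z) * mu.
  exact: E.
have e11 : dot (partial 1 F z) (partial 1 F z) = dot (F z) (F z) * mu.
  exact: E.
have e01 : dot (partial 0 F z) (partial 1 F z) = 0.
  by apply: etrans (E 0 1) _; rewrite mulr0.
split; [exact: etrans e00 (esym e11)|exact: e01|].
by apply: (cross_conformal_neq0 _ e00 e11 e01); rewrite mulr_gt0.
Qed.

(** The scalings of the frame and of the normalization cancel, so the Gauss map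
    is computed from the Euclidean unit normal. *)
Lemma normal_coordinates F z : F z != 0 ->
    cross (partial 0 F z) (partial 1 F z) != 0 ->
  \row_j metric_dot (dmu2 (F z)) (local_normal F z) (frame j (F z)) =
    (enorm (cross (partial 0 F z) (partial 1 F z)))^-1 *:
      cross (partial 0 F z) (partial 1 F z).
Proof.
rewrite /local_normal; move: (cross _ _) (F z) => c x x0 c0.
have ex0 := enorm_gt0 x0; have ec0 := enorm_gt0 c0.
have -> : Num.sqrt (metric_dot (dmu2 x) c c) = (enorm x)^-1 * enorm c.
  rewrite metric_dot_dmu2 -!enorm_sqr -exprVn -exprMn sqrtr_sqr ger0_norm//.
  by rewrite mulr_ge0 ?invr_ge0 ?ltW.
apply/rowP => j.
rewrite !mxE metric_dot_dmu2 -enorm_sqr /frame dotZr dotZl dot_delta.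
by field; rewrite !gt_eqF.
Qed.

End ConformalMetric.

(** * The Gauss map in coordinates of the Riemann sphere *)

Local Open Scope complex_scope.

Section Sphere.
Variable R : realType.
Implicit Types (n : 'rV[R]_3) (w : riemann_sphere R).

Lemma complex_divr (x y k : R) : (x +i* y) / k%:C = (x / k) +i* (y / k).
Proof. by rewrite -fmorphV /=; simpc. Qed.

Lemma complex_invr (x y : R) :
  (x +i* y)^-1 = (x / (x ^+ 2 + y ^+ 2)) +i* (- y / (x ^+ 2 + y ^+ 2)).
Proof. by rewrite mulNr. Qed.

Lemma addr1_gt0 (x : R) : x ^+ 2 <= 1 -> x != -1 -> 0 < 1 + x.
Proof.
move=> x1 xN1; rewrite lt0r addrC addr_eq0 xN1 /= leNgt; apply/negP => x0; nra.
Qed.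

(** The coordinate [w] of the Riemann sphere gives back the point [n], up to a
    positive factor, by the polynomial formula with [s = 1]. *)
Lemma stereo_dir n : dot n n = 1 -> stereo n <> None ->
  exists2 k, 0 < k & sphere_dir 1 (complex.Re (sphere_coord (stereo n)))
     (complex.Im (sphere_coord (stereo n))) = k *: n.
Proof.
move=> n1; rewrite /stereo; case: eqP => // n2 _; rewrite complex_divr /=.
have e : n 0 0 ^+ 2 + n 0 1 ^+ 2 = 1 - n 0 2%:R ^+ 2 by rewrite -n1 dotE; ring.
have d0 : 0 < 1 + n 0 2%:R.
  apply: addr1_gt0; last exact/eqP.
  by rewrite -subr_ge0 -e addr_ge0 ?sqr_ge0.
exists (2 / (1 + n 0 2%:R)); first by rewrite divr_gt0.
apply: rV3P; rewrite !mxE /=; [by field; rewrite gt_eqF..|].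
transitivity (1 - (n 0 0 ^+ 2 + n 0 1 ^+ 2) / (1 + n 0 2%:R) ^+ 2).
  by field; rewrite gt_eqF.
by rewrite e; field; rewrite gt_eqF.
Qed.

(** The same for the coordinate [1 / w], with [s = -1].  At the south pole the
    dummy value 0 of the coordinate is the right one. *)
Lemma stereo_dir_inv n : dot n n = 1 -> stereo n <> Some 0 ->
  exists2 k, 0 < k & sphere_dir (-1) (complex.Re (sphere_coord_inv (stereo n)))
     (complex.Im (sphere_coord_inv (stereo n))) = k *: n.
Proof.
move=> n1 g0.
have e : n 0 0 ^+ 2 + n 0 1 ^+ 2 = (1 - n 0 2%:R) * (1 + n 0 2%:R).
  by transitivity (dot n n - n 0 2%:R ^+ 2); [rewrite dotE|rewrite n1]; ring.
have n21 : n 0 2%:R != 1.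
  apply: contra_notN g0 => /eqP n21; move: e; rewrite n21 subrr mul0r => /eqP.
  rewrite paddr_eq0 ?sqr_ge0// !sqrf_eq0 => /andP[/eqP e0 /eqP e1].
  rewrite /stereo n21 e0 e1 -subr_eq0 opprK -(natrD _ 1 1) pnatr_eq0 /=.
  by rewrite complex_divr !mul0r.
have d0 : 0 < 1 - n 0 2%:R.
  apply: addr1_gt0; last by rewrite eqr_opp.
  by rewrite sqrrN -n1 dotE !expr2 lerDr addr_ge0 // -expr2 sqr_ge0.
have -> : sphere_coord_inv (stereo n) =
    (n 0 0 / (1 - n 0 2%:R)) +i* (- n 0 1 / (1 - n 0 2%:R)).
  rewrite /stereo; case: eqP => [n2|/eqP n2].
    move: e; rewrite n2 subrr mulr0 => /eqP.
    rewrite paddr_eq0 ?sqr_ge0// !sqrf_eq0 => /andP[/eqP e0 /eqP e1].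
    by rewrite e0 e1 oppr0 !mul0r.
  rewrite /sphere_coord_inv complex_divr complex_invr !expr_div_n -mulrDl e.
  have n'2 : 1 + n 0 2%:R != 0 by rewrite addrC addr_eq0.
  by congr (_ +i* _); field; rewrite n'2 gt_eqF.
exists (2 / (1 - n 0 2%:R)); first by rewrite divr_gt0.
apply: rV3P; rewrite !mxE /=; [by field; rewrite gt_eqF..|].
transitivity ((n 0 0 ^+ 2 + n 0 1 ^+ 2) / (1 - n 0 2%:R) ^+ 2 - 1).
  by field; rewrite gt_eqF.
by rewrite e; field; rewrite gt_eqF.
Qed.

Lemma sphere_coord_inj w1 w2 : w1 <> None -> w2 <> None ->
  sphere_coord w1 = sphere_coord w2 -> w1 = w2.
Proof. by case: w1 w2 => [c1|] [c2|]//= _ _ ->. Qed.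

Lemma sphere_coord_inv_inj w1 w2 : w1 <> Some 0 -> w2 <> Some 0 ->
  sphere_coord_inv w1 = sphere_coord_inv w2 -> w1 = w2.
Proof.
case: w1 w2 => [c1|] [c2|]//= h1 h2.
- by move=> /invr_inj ->.
- by move=> /eqP; rewrite invr_eq0 => /eqP c10; rewrite c10 in h1.
- by move=> /esym/eqP; rewrite invr_eq0 => /eqP c20; rewrite c20 in h2.
Qed.

Lemma open_neq_None : open [set w : riemann_sphere R | w <> None].
Proof.
have -> : [set w : riemann_sphere R | w <> None] = Some @` [set: R[i]^o].
  by apply/seteqP; split => [[c|]//= _|w /= [c _ <-]//]; exists c.
exact/one_point_compactification_open_some/openT.
Qed.

Lemma open_neq_Some0 : open [set w : riemann_sphere R | w <> Some 0].
Proof.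
have c0 : closed [set (0 : R[i]^o)].
  exact/accessible_closed_set1/hausdorff_accessible/norm_hausdorff.
rewrite openE => -[c|] /= h.
- have : nbhs (c : R[i]^o) (~` [set 0]).
    apply: open_nbhs_nbhs; split; first exact: closed_openC.
    by move=> /= c00; apply: h; rewrite c00.
  move/one_point_compactification_some_nbhs; apply: filterS => w [d d0 <-] [].
  exact: d0.
- exists [set 0]; first by split => //; exact: compact_set1.
  by move=> w [[d d0 <-] []|->//]; exact: d0.
Qed.

(** The Cauchy-Riemann equations of the conjugate of [f]. *)
Lemma antiholomorphic_partials (f : 'rV[R]_2 -> R[i]) z :
    antiholomorphic_at f z ->
  partial 0 (fun y => complex.Re (f y)) z =
    - partial 1 (fun y => complex.Im (f y)) z /\
  partial 0 (fun y => complex.Im (f y)) z =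
    partial 1 (fun y => complex.Re (f y)) z.
Proof.
move=> [_ _] /eqP; rewrite /partial_z mulf_eq0 invr_eq0 pnatr_eq0 orbF.
rewrite subr_eq0 => /eqP; simpc => -[-> ->]; split; ring.
Qed.

End Sphere.

Local Close Scope complex_scope.

(** * Local constancy on the surface *)

Section Surface.
Variables (R : realType) (T : topologicalType) (S : riemannian_surface R T).
Variables (X N : T -> 'rV[R]_3).
Hypotheses (immX : conformal_immersion S X) (minX : minimal S X).
Hypotheses (nN : unit_normal S X N) (ahG : antiholomorphic S (gauss_map X N)).

Let g := gauss_map X N.

Lemma gauss_map_param i z : chart_img i z ->
    cross (partial 0 (X \o param i) z) (partial 1 (X \o param i) z) != 0 ->
  exists n k, [/\ dot n n = 1, 0 < k, g (@param _ _ S i z) = stereo n &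
    n = k *: cross (partial 0 (X \o param i) z) (partial 1 (X \o param i) z)].
Proof.
move=> iz c0; have X0 := immX.1 (param i z).
have E := @normal_coordinates R (X \o param i) z X0 c0.
move: E c0; move: (cross _ _) => c E c0; have ec0 := enorm_gt0 c0.
exists ((enorm c)^-1 *: c), (enorm c)^-1; split => //.
- by rewrite dotZl dotZr -enorm_sqr; field; rewrite gt_eqF.
- by rewrite invr_gt0.
- by rewrite -E /g /gauss_map (nN iz).
Qed.

(** [phi] is one of the two standard coordinates of the Riemann sphere, [e] the
    point that it misses, and [s] the sign under which it parametrizes the
    sphere.  Continuity of [g] is what keeps [g] away from [e] near [z]; there
    both real components of the coordinate have zero gradient. *)
Lemma coordinate_locally_constant (i : chart_index S) s
    (phi : riemann_sphere R -> R[i]) e :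
    s = 1 \/ s = -1 ->
    open [set w | w <> e] ->
    (forall w1 w2, w1 <> e -> w2 <> e -> phi w1 = phi w2 -> w1 = w2) ->
    (forall n, dot n n = 1 -> stereo n <> e -> exists2 k, 0 < k &
       sphere_dir s (complex.Re (phi (stereo n))) (complex.Im (phi (stereo n)))
         = k *: n) ->
    (forall z, chart_img i z -> g (param i z) <> e ->
       antiholomorphic_at (phi \o g \o param i) z) ->
  forall z, chart_img i z -> g (param i z) <> e ->
    \forall y \near z, g (param i y) = g (param i z).
Proof.
move=> s1 oe phi_inj phi_dir ah z iz gz.
pose F := X \o param i; pose c y := cross (partial 0 F y) (partial 1 F y).
pose U := chart_img i `&` [set y | g (param i y) <> e].
have oU : open U.
  have gc : {in chart_img i, continuous (g \o param i)}.
    move=> y /set_mem iy; apply: continuous_comp; last exact: ahG.1.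
    have := param_continuous (i := i).
    rewrite continuous_open_subspace; last exact: chart_img_open.
    by apply; apply/mem_set.
  by have /(_ _ oe) := (continuous_inP _ (chart_img_open (i := i))).1 gc.
have [smF confF] := immX.2 i.
have dF y : chart_img i y -> differentiable F y by move: y; have [] := smF 1%N.
have ddF j y : chart_img i y -> differentiable (partial j F) y.
  by move: y; have [_ /(_ j)[]] := smF 2%N.
have F0 y : F y != 0 by exact: immX.1.
have geo y : chart_img i y ->
    exists2 mu, 0 < mu & pullback (@dmu2 R) F y = mu%:M.
  move=> iy; have [_ [k k0 kE]] := confF y iy.
  exists (k * conf_factor i y); first by rewrite mulr_gt0// conf_factor_gt0.
  by rewrite kE /surf_metric scale_scalar_mx.
have part y : chart_img i y ->
  [/\ dot (partial 0 F y) (partial 0 F y) = dot (partial 1 F y) (partial 1 F y),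
      dot (partial 0 F y) (partial 1 F y) = 0 & c y != 0].
  move=> iy; have [mu mu0 pb] := geo y iy.
  by apply: conformal_partials pb => //; exact: dF.
pose a y := complex.Re (phi (g (param i y))).
pose b y := complex.Im (phi (g (param i y))).
have dirU y : exists k, U y -> 0 < k /\ sphere_dir s (a y) (b y) = k *: c y.
  have [[iy gy]|nU] := pselect (U y); last by exists 0 => /nU.
  have [_ _ cy] := part y iy.
  have [n [k [n1 k0 gE nE]]] := gauss_map_param iy cy.
  rewrite /= gE in gy; have [l l0 lE] := phi_dir n n1 gy.
  exists (l * k) => _; split; first exact: mulr_gt0.
  by rewrite /a /b gE lE nE scalerA.
have [k kE] := choice dirU.
have ab y : U y -> antiholomorphic_at (phi \o g \o param i) y.
  by move=> [iy gy]; exact: ah.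
have dab y : U y -> differentiable a y /\ differentiable b y.
  by move=> /ab[].
have cr y : U y ->
    partial 0 a y = - partial 1 b y /\ partial 0 b y = partial 1 a y.
  by move=> /ab; apply: antiholomorphic_partials.
have crit y : U y -> partial 0 a y = 0 /\ partial 0 b y = 0.
  move: y; apply: (minimal_antiholomorphic_critical oU s1 (k := k)).
  - by move=> y _; exact: F0.
  - by move=> y [iy _]; exact: dF.
  - by move=> j y [iy _]; exact: ddF.
  - by move=> y [iy _]; have [] := part y iy.
  - by move=> y [iy _]; have [] := part y iy.
  - by move=> y [iy _]; have [] := part y iy.
  - move=> y [iy _]; have [iso _ cy] := part y iy; have [mu mu0 pb] := geo y iy.
    exact: minimal_dmu2 pb cy iso (minX iy).
  - exact: kE.
  - exact: dab.
  - exact: cr.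
have {}crit j y : U y -> partial j a y = 0 /\ partial j b y = 0.
  move=> Uy; have [a0 b0] := crit y Uy; have [a0b1 b0a1] := cr y Uy.
  case: (ord2P j) => ->; last split.
  - by split; [exact: a0|exact: b0].
  - exact: etrans (esym b0a1) b0.
  - by apply: oppr_inj; rewrite oppr0; exact: etrans (esym a0b1) a0.
have [r /= r0 rU] : nbhs_ball z U.
  by apply/nbhs_ballP; apply: open_nbhs_nbhs; split.
apply/nbhs_ballP; exists r => //= y zy.
have [_ gy] := rU _ zy.
have aE : a y = a z.
  apply: (partial0_constant _ _ zy) => [w /rU/dab[]//|j w /rU Uw].
  by have [] := crit j w Uw.
have bE : b y = b z.
  apply: (partial0_constant _ _ zy) => [w /rU/dab[]//|j w /rU Uw].
  by have [] := crit j w Uw.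
apply: phi_inj => //.
by move: aE bE; rewrite /a /b; case: (phi _) (phi _) => [? ?] [? ?] /= -> ->.
Qed.

Lemma gauss_map_locally_constant p : \forall q \near p, g q = g p.
Proof.
have [i ip] := chart_dom_cover S p.
have iz : chart_img i (chart i p) by exists p.
have pE := chartK ip.
have chart_cst :
    \forall y \near chart i p, g (param i y) = g (param i (chart i p)).
  have [gN|gN] := pselect (g p = None).
    apply: (@coordinate_locally_constant i (-1)
              (@sphere_coord_inv R) (Some 0)) => //.
    - by right.
    - exact: open_neq_Some0.
    - exact: sphere_coord_inv_inj.
    - exact: stereo_dir_inv.
    - by move=> z zi; have [] := ahG.2 i z zi.
    - by rewrite pE gN.
  apply: (@coordinate_locally_constant i 1 (@sphere_coord R) None) => //.
  - by left.
  - exact: open_neq_None.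
  - exact: sphere_coord_inj.
  - exact: stereo_dir.
  - by move=> z zi; have [] := ahG.2 i z zi.
  - by rewrite pE.
have := chart_continuous (i := i).
rewrite continuous_open_subspace; last exact: chart_dom_open.
move=> /(_ p (mem_set ip)) /(_ _ chart_cst) near_p.
have near_dom : \forall q \near p, chart_dom i q.
  by apply: open_nbhs_nbhs; split => //; exact: chart_dom_open.
near=> q.
have iq : chart_dom i q by near: q.
rewrite -(chartK iq) -[in RHS]pE.
by near: q.
Unshelve. all: by end_near. Qed.

End Surface.

Lemma locally_constant_connected (T : topologicalType) (V : Type) (f : T -> V) :
  connected [set: T] -> (forall p, \forall q \near p, f q = f p) ->
  forall p q, f p = f q.
Proof.
move=> cT lc p q.
have oP (P : V -> Prop) : open [set x | P (f x)].
  by rewrite openE => x /= Px; apply: filterS (lc x) => y /= ->.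
suff E : [set x | f p = f x] = [set: T].
  by have : [set: T] q by []; rewrite -E.
apply: cT.
- by exists p.
- by exists [set x | f p = f x]; rewrite ?setTI.
- exists [set x | f p = f x]; rewrite ?setTI//.
  by rewrite -openC; exact: oP (fun v => ~ (f p = v)).
Qed.

Theorem proposition4p7 (R : realType) (T : topologicalType)
    (S : riemannian_surface R T)
    (T_hausdorff : hausdorff_space T)
    (T_second_countable : @second_countable T)
    (T_connected : connected [set: T]) :
  ~ exists X N : T -> 'rV[R]_3,
      [/\ conformal_immersion S X,
          minimal S X,
          unit_normal S X N,
          antiholomorphic S (gauss_map X N) &
          exists p q, gauss_map X N p <> gauss_map X N q].
Proof.
move=> [X [N [immX minX nN ahG [p [q]]]]]; apply.
apply: (locally_constant_connected T_connected).
exact: gauss_map_locally_constant immX minX nN ahG.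
Qed.
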